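(* For every integer $n \geq 1$, the polynomial $f(6n,q)$ is divisible by $2(1+q)(1+q^2)$ (in $\mathbb{Z}[q]$).
   Context: For an indeterminate $q$ let $[n]_q = \frac{1-q^n}{1-q} = 1+q+\cdots+q^{n-1}$ and let $\begin{bmatrix} n \\ k \end{bmatrix} = \frac{[n]_q [n-1]_q\cdots[n-k+1]_q}{[1]_q[2]_q\cdots[k]_q}$ be the $q$-binomial coefficient (a polynomial in $q$ with integer coefficients). The $q$-Fibonacci numbers $f(n,q)$ are the polynomials in $\mathbb{Z}[q]$ $$f(n,q) = \sum_{k=0}^{\lfloor (n-1)/2 \rfloor} q^{\binom{k}{2}} \begin{bmatrix} n-1-k \\ k \end{bmatrix}.$$ *)

(* Defs.v *)
From HB Require Import structures.
From mathcomp Require Import all_boot all_order all_algebra.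

Set Implicit Arguments.
Unset Strict Implicit.
Unset Printing Implicit Defensive.

Import GRing.Theory.
Local Open Scope ring_scope.

(* The indeterminate q is 'X in {poly int}. *)

Definition qint (n : nat) : {poly int} := \sum_(i < n) 'X^i.

Definition qbinom_num (n k : nat) : {poly int} := \prod_(i < k) qint (n - i).

Definition qbinom_den (k : nat) : {poly int} := \prod_(i < k) qint i.+1.

(* The denominator is monic, so the division takes place in Z[q]; it is exact
   by qbinomP below. When n < k the numerator has the factor qint 0 = 0. *)
Definition qbinom (n k : nat) : {poly int} := qbinom_num n k %/ qbinom_den k.

(* floor((n - 1) / 2) + 1 = (n + 1) %/ 2, which also makes the sum empty at
   n = 0; hence the strict bound. On this range k <= n - 1 - k, so the
   truncated subtractions are exact. *)
Definition qfib (n : nat) : {poly int} :=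
  \sum_(k < n.+1 %/ 2) 'X^('C(k, 2)) * qbinom (n - 1 - k) k.

Lemma qintE (n : nat) : (1 - 'X) * qint n = 1 - 'X^n.
Proof.
by rewrite -[in RHS](expr1n _ n) subrXX /qint; congr (_ * _);
   apply: eq_bigr => i _; rewrite expr1n mul1r.
Qed.

Lemma qintD (m n : nat) : qint (m + n) = qint m + 'X^m * qint n.
Proof.
rewrite /qint big_split_ord /=; congr (_ + _); rewrite mulr_sumr.
by apply: eq_bigr => i _; rewrite exprD.
Qed.

Lemma qint_monic (n : nat) : qint n.+1 \is monic.
Proof.
have -> : qint n.+1 = \poly_(i < n.+1) 1.
  by rewrite poly_def; apply: eq_bigr => i _; rewrite scale1r.
by rewrite monicE lead_coef_poly ?oner_eq0.
Qed.

Lemma qbinom_den_monic (k : nat) : qbinom_den k \is monic.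
Proof. by apply: monic_prod => i _; apply: qint_monic. Qed.

Lemma qbinom_num_dvd (n k : nat) :
  exists g : {poly int}, qbinom_num n k = g * qbinom_den k.
Proof.
elim: n k => [|n IHn] [|k].
- by exists 1; rewrite /qbinom_num /qbinom_den !big_ord0 mul1r.
- by exists 0; rewrite /qbinom_num big_ord_recl /qint big_ord0 !mul0r.
- by exists 1; rewrite /qbinom_num /qbinom_den !big_ord0 mul1r.
have numS : qbinom_num n.+1 k.+1 = qint n.+1 * qbinom_num n k.
  by rewrite /qbinom_num big_ord_recl subn0.
have [g gE] := IHn k; have [h hE] := IHn k.+1.
have denS : qbinom_den k.+1 = qbinom_den k * qint k.+1.
  by rewrite /qbinom_den big_ord_recr.
have numSr : qbinom_num n k.+1 = qbinom_num n k * qint (n - k).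
  by rewrite /qbinom_num big_ord_recr.
exists (g + 'X^(k.+1) * h).
rewrite mulrDl -mulrA -hE numSr denS mulrA -gE numS.
have [le_kn | lt_nk] := leqP k n.
  have -> : qint n.+1 = qint k.+1 + 'X^(k.+1) * qint (n - k).
    by rewrite -qintD addSn subnKC.
  by rewrite mulrC mulrDr mulrCA.
suff -> : qbinom_num n k = 0 by rewrite !(mulr0, mul0r) addr0.
rewrite /qbinom_num (bigD1 (Ordinal lt_nk)) //= subnn.
by rewrite /qint big_ord0 mul0r.
Qed.

Lemma qbinomP (n k : nat) : qbinom n k * qbinom_den k = qbinom_num n k.
Proof.
have [g gE] := qbinom_num_dvd n k.
by rewrite /qbinom gE Pdiv.IdomainMonic.mulpK // qbinom_den_monic.
Qed.

(* Main.v *)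
Require Import Defs.
From mathcomp Require Import all_boot all_order all_algebra.
From mathcomp Require Import zify ring.

Import GRing.Theory.
Local Open Scope ring_scope.

(** The two q-Pascal rules, applied to f(n, q) and to its companion sum with
    k-th term scaled by q^(-k), combine into the linear recurrence
      f(n+4) = f(n+3) + q^(n+1) f(n+1) + q^n f(n).
    Iterating it, f(n+6) = (1 + q^(n+3)) f(n+3) + q^n f(n) + 2 (...), so every
    f(3m) is even because f(0) = 0 and f(3) = 2.  Modulo
    (1 + q)(1 + q^2) = 1 + q + q^2 + q^3, a divisor of q^4 - 1, the coefficients
    of the recurrence have period 4, and computing the terms up to f(15) gives
    f(n+12) = q^2 f(n); since f(0) and f(6) vanish there, so does every f(6m).
    The modulus is monic, hence the two divisibilities combine. *)

Lemma qbinom_small (n k : nat) : (n < k)%N -> qbinom n k = 0.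
Proof.
move=> lt_nk; rewrite /qbinom.
suff -> : qbinom_num n k = 0 by rewrite div0p.
rewrite /qbinom_num (bigD1 (Ordinal lt_nk)) //= subnn.
by rewrite /qint big_ord0 mul0r.
Qed.

Lemma qbinomn0 (n : nat) : qbinom n 0 = 1.
Proof.
by have := qbinomP n 0; rewrite /qbinom_num /qbinom_den !big_ord0 mulr1.
Qed.

Lemma qbinom_den_neq0 (k : nat) : qbinom_den k != 0.
Proof. exact: monic_neq0 (qbinom_den_monic k). Qed.

Lemma qbinomS_den (n k : nat) :
  qbinom n.+1 k.+1 * qbinom_den k.+1 = qint n.+1 * qbinom_num n k.
Proof. by rewrite qbinomP /qbinom_num big_ord_recl subn0. Qed.

Lemma qbinom_den_rec (n k : nat) :
  qbinom n k.+1 * qbinom_den k.+1 = qint (n - k) * qbinom_num n k.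
Proof. by rewrite qbinomP /qbinom_num big_ord_recr mulrC. Qed.

Lemma qbinom_denS (n k : nat) :
  qbinom n k * qbinom_den k.+1 = qint k.+1 * qbinom_num n k.
Proof.
by rewrite /qbinom_den big_ord_recr /= mulrA -/(qbinom_den k) qbinomP mulrC.
Qed.

(** Clearing [qbinom_den k.+1] leaves the splitting [n+1] = [k+1] + q^(k+1) [n-k]; [qbinom_pascalr]
    splits off [n-k] first instead. *)
Lemma qbinom_pascall (n k : nat) :
  qbinom n.+1 k.+1 = 'X^(k.+1) * qbinom n k.+1 + qbinom n k.
Proof.
have [le_kn | lt_nk] := leqP k n; last first.
  by rewrite !qbinom_small ?mulr0 ?addr0 //; lia.
apply: (mulIf (qbinom_den_neq0 k.+1)).
rewrite mulrDl -mulrA qbinomS_den qbinom_den_rec qbinom_denS.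
have -> : n.+1 = (k.+1 + (n - k))%N by lia.
by rewrite qintD; ring.
Qed.

Lemma qbinom_pascalr (n k : nat) :
  qbinom n.+1 k.+1 = qbinom n k.+1 + 'X^(n - k) * qbinom n k.
Proof.
have [le_kn | lt_nk] := leqP k n; last first.
  by rewrite !qbinom_small ?mulr0 ?addr0 //; lia.
apply: (mulIf (qbinom_den_neq0 k.+1)).
rewrite mulrDl -mulrA qbinomS_den qbinom_den_rec qbinom_denS.
have -> : n.+1 = ((n - k) + k.+1)%N by lia.
by rewrite qintD; ring.
Qed.

(** The added terms have n - k < k and vanish; the simpler range makes index shifts easy. *)
Lemma qfibS (n : nat) :
  qfib n.+1 = \sum_(k < n.+1) 'X^('C(k, 2)) * qbinom (n - k) k.
Proof.
rewrite /qfib subn1 /= (big_ord_widen n.+1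
  (fun k => 'X^('C(k, 2)) * qbinom (n - k) k)); last lia.
rewrite big_mkcond; apply: eq_bigr => k _.
by case: ifP => // hk; rewrite qbinom_small ?mulr0 //; lia.
Qed.

(* This is q^n F_(n+1)(1/q), where F_n(s) inserts s^k into the sum defining
   f(n, q), written without negative powers of q. *)
Definition qfib_shift (n : nat) : {poly int} :=
  \sum_(k < n.+1) 'X^('C(k, 2) + (n - k)) * qbinom (n - k) k.

Lemma qfib_rec_shift (n : nat) : qfib n.+3 = qfib n.+2 + qfib_shift n.
Proof.
rewrite !qfibS [\sum_(k < n.+2) _]big_ord_recl [LHS]big_ord_recl /=.
rewrite !subn0 !qbinomn0 -addrA; congr (_ + _).
rewrite big_ord_recr /= [qbinom _ n.+2]qbinom_small; last by rewrite /bump; lia.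
rewrite mulr0 addr0 /qfib_shift -big_split; apply: eq_bigr => -[k hk] _ /=.
rewrite /bump !add1n subSS subSn; last lia.
rewrite qbinom_pascalr mulrDr; congr (_ + _).
(* For k > n - k the exponent [n - k - k] is truncated, but the binomial beside it is 0. *)
have [hk2|hk2] := leqP k (n - k); last by rewrite qbinom_small // !mulr0.
by rewrite mulrA -exprD binS bin1; congr ('X^_ * _); lia.
Qed.

(** In the term of index k + 1, C(k+1, 2) = C(k, 2) + k, so the scaling q^(n+1-k) leaves both Pascal
    summands with a power of q free of k beyond the usual weight. *)
Lemma qfib_shift_rec (n : nat) :
  qfib_shift n.+2 = 'X^(n.+2) * qfib n.+2 + 'X^(n.+1) * qfib n.+1.
Proof.
rewrite !qfibS /qfib_shift [\sum_(k < n.+2) _]big_ord_recl [LHS]big_ord_recl /=.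
rewrite !subn0 !qbinomn0 !mulr1 mulrDr mulr1 -addrA; congr (_ + _).
rewrite big_ord_recr /= [qbinom _ n.+2]qbinom_small; last by rewrite /bump; lia.
rewrite mulr0 addr0 !mulr_sumr -big_split; apply: eq_bigr => -[k hk] _ /=.
rewrite /bump !add1n subSS subSn; last lia.
rewrite qbinom_pascall mulrDr !mulrA -!exprD binS bin1.
by congr ('X^_ * _ + 'X^_ * _); lia.
Qed.

Lemma qfib0 : qfib 0 = 0.
Proof. by rewrite /qfib big_ord0. Qed.

Lemma qfib1 : qfib 1 = 1.
Proof. by rewrite qfibS big_ord1 qbinomn0 mulr1. Qed.

Lemma qfib2 : qfib 2 = 1.
Proof.
rewrite qfibS !big_ord_recl big_ord0 qbinomn0 qbinom_small //.
by rewrite mulr0 mulr1 !addr0.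
Qed.

Lemma qfib3 : qfib 3 = 2.
Proof. by rewrite qfib_rec_shift qfib2 /qfib_shift big_ord1 qbinomn0 mulr1. Qed.

Lemma qfib_rec (n : nat) :
  qfib n.+4 = qfib n.+3 + 'X^(n.+1) * qfib n.+1 + 'X^n * qfib n.
Proof.
rewrite qfib_rec_shift -addrA; congr (_ + _).
(* At n = 0 the empty sum [qfib 0] appears, which [qfibS] does not cover. *)
case: n => [|n]; last exact: qfib_shift_rec.
rewrite qfib0 qfib1 mulr0 addr0 mulr1 /qfib_shift !big_ord_recl big_ord0.
by rewrite qbinomn0 [qbinom _ (lift _ _)]qbinom_small // mulr0 mulr1 !addr0.
Qed.

Lemma qfib_mul3_even (m : nat) : exists g : {poly int}, qfib (3 * m) = 2 * g.
Proof.
suff [] : (exists g, qfib (3 * m) = 2 * g) /\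
          (exists g, qfib (3 * m.+1) = 2 * g) by [].
elim: m => [|m [[a aE] [b bE]]].
  split; first by exists 0; rewrite muln0 qfib0 mulr0.
  by exists 1; rewrite muln1 qfib3 mulr1.
split; first by exists b.
move: bE; have -> : (3 * m.+1 = (3 * m).+3)%N by lia.
have -> : (3 * m.+2 = (3 * m).+2.+4)%N by lia.
set k := (3 * m)%N in aE * => bE.
(* Unfolding three times produces the terms in [qfib k.+1] and [qfib k.+2] twice each; this is half
   of the total. *)
exists (b + 'X^k * a + 'X^(k.+1) * qfib k.+1 + 'X^(k.+2) * qfib k.+2
        + 'X^(k.+3) * b).
by rewrite !(qfib_rec k.+2, qfib_rec k.+1, qfib_rec k) bE aE; ring.
Qed.

Definition qint4 : {poly int} := (1 + 'X) * (1 + 'X^2).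

(** The explicit quotient [w] turns each reduction of a remainder into an identity for [ring]. *)
Lemma qfib_cong_step (w : {poly int}) {n : nat} {r0 r1 r3 r : {poly int}} :
  qint4 %| qfib n - r0 -> qint4 %| qfib n.+1 - r1 -> qint4 %| qfib n.+3 - r3 ->
  r3 + 'X^(n.+1) * r1 + 'X^n * r0 = r + w * qint4 ->
  qint4 %| qfib n.+4 - r.
Proof.
move=> d0 d1 d3 e.
have -> : qfib n.+4 - r = (qfib n.+3 - r3) + 'X^(n.+1) * (qfib n.+1 - r1)
    + 'X^n * (qfib n - r0) + w * qint4.
  have -> : r = r3 + 'X^(n.+1) * r1 + 'X^n * r0 - w * qint4 by rewrite e addrK.
  by rewrite qfib_rec; ring.
by do !apply: Pdiv.Idomain.dvdp_add => //; apply: Pdiv.Idomain.dvdp_mull.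
Qed.

(* The quotients supplied to qfib_cong_step come from dividing the right-hand
   side of the recurrence by 1 + q + q^2 + q^3. *)
Lemma qfib_cong_table :
  [/\ qint4 %| qfib 6, qint4 %| qfib 12, qint4 %| qfib 13 - 'X^2,
      qint4 %| qfib 14 - 'X^2 & qint4 %| qfib 15 - 2 * 'X^2].
Proof.
have d0 : qint4 %| qfib 0 - 0 by rewrite qfib0 subrr dvdp0.
have d1 : qint4 %| qfib 1 - 1 by rewrite qfib1 subrr dvdp0.
have d2 : qint4 %| qfib 2 - 1 by rewrite qfib2 subrr dvdp0.
have d3 : qint4 %| qfib 3 - 2 by rewrite qfib3 subrr dvdp0.
have d4 : qint4 %| qfib 4 - (2 + 'X).
  by apply: (qfib_cong_step 0 d0 d1 d3); rewrite /qint4; ring.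
have d5 : qint4 %| qfib 5 - (2 + 2 * 'X + 'X^2).
  by apply: (qfib_cong_step 0 d1 d2 d4); rewrite /qint4; ring.
have d6 : qint4 %| qfib 6 - 0.
  by apply: (qfib_cong_step 2 d2 d3 d5); rewrite /qint4; ring.
have d7 : qint4 %| qfib 7 - (- 'X - 2 * 'X^2).
  by apply: (qfib_cong_step ('X + 'X^2) d3 d4 d6); rewrite /qint4; ring.
have d8 : qint4 %| qfib 8 - (1 + 'X - 'X^2).
  apply: (qfib_cong_step (- 1 - 'X + 'X^2 + 'X^3 + 'X^4) d4 d5 d7).
  by rewrite /qint4; ring.
have d9 : qint4 %| qfib 9 - 2 * 'X.
  apply: (qfib_cong_step (1 - 2 * 'X + 'X^3 + 'X^4) d5 d6 d8).
  by rewrite /qint4; ring.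
have d10 : qint4 %| qfib 10 - (- 1).
  apply: (qfib_cong_step (1 + 'X - 2 * 'X^2 + 'X^4 + 'X^5 - 2 * 'X^6) d6 d7 d9).
  by rewrite /qint4; ring.
have d11 : qint4 %| qfib 11 - (- 1 - 'X - 'X^2).
  apply: (qfib_cong_step ('X - 'X^3 + 'X^5 - 'X^7) d7 d8 d10).
  by rewrite /qint4; ring.
have d12 : qint4 %| qfib 12 - 0.
  apply: (qfib_cong_step (- 1 + 'X^3 - 'X^4 + 'X^7) d8 d9 d11).
  by rewrite /qint4; ring.
have d13 : qint4 %| qfib 13 - 'X^2.
  apply: (qfib_cong_step (- 'X^2 + 'X^3 - 'X^6 + 'X^7) d9 d10 d12).
  by rewrite /qint4; ring.
have d14 : qint4 %| qfib 14 - 'X^2.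
  by apply: (qfib_cong_step (- 'X^10) d10 d11 d13); rewrite /qint4; ring.
have d15 : qint4 %| qfib 15 - 2 * 'X^2.
  apply: (qfib_cong_step (- 'X^2 + 'X^3 - 'X^6 + 'X^7 - 'X^10) d11 d12 d14).
  by rewrite /qint4; ring.
by split=> //; rewrite -[qfib _]subr0.
Qed.

Lemma qint4_monic : qint4 \is monic.
Proof.
rewrite /qint4 ['X^2]lock addrC -lock [1 + 'X^2]addrC.
rewrite rpredM // monicE lead_coefDl ?lead_coefX ?lead_coefXn //.
  by rewrite size_polyX size_poly1.
by rewrite size_polyXn size_poly1.
Qed.

Lemma qfib_add12 (n : nat) : qint4 %| qfib (n + 12) - 'X^2 * qfib n.
Proof.
have [_ d12 d13 d14 d15] := qfib_cong_table.
(* The recurrence has order four, so four consecutive congruences are carried along. *)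
suff [] : [/\ qint4 %| qfib (n + 12) - 'X^2 * qfib n,
              qint4 %| qfib (n.+1 + 12) - 'X^2 * qfib n.+1,
              qint4 %| qfib (n.+2 + 12) - 'X^2 * qfib n.+2 &
              qint4 %| qfib (n.+3 + 12) - 'X^2 * qfib n.+3] by [].
elim: n => [|n [e0 e1 e2 e3]].
  by rewrite qfib0 qfib1 qfib2 qfib3 mulr0 subr0 mulr1 [_ * 2]mulrC.
split=> //; rewrite addSn addSn addSn addSn qfib_rec (qfib_rec n) -!addSn.
set S := (X in _ %| X).
(* The last summand is the change in the coefficients: q^12 - 1 = (q - 1) (1 + q^4 + q^8)
   [qint4]. *)
have -> : S = (qfib (n.+3 + 12) - 'X^2 * qfib n.+3)
    + 'X^((n + 12).+1) * (qfib (n.+1 + 12) - 'X^2 * qfib n.+1)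
    + 'X^(n + 12) * (qfib (n + 12) - 'X^2 * qfib n)
    + ('X^(n.+3) * qfib n.+1 + 'X^(n.+2) * qfib n) * ('X - 1)
        * (1 + 'X^4 + 'X^8) * qint4.
  by rewrite /S /qint4 !addSn !exprS !exprD; ring.
by do !apply: Pdiv.Idomain.dvdp_add => //; apply: Pdiv.Idomain.dvdp_mull.
Qed.

Lemma qfib_mul6_qint4 (m : nat) : qint4 %| qfib (6 * m).
Proof.
have [d6 _ _ _ _] := qfib_cong_table.
suff [] : qint4 %| qfib (6 * m) /\ qint4 %| qfib (6 * m.+1) by [].
elim: m => [|m [dm dm1]]; first by rewrite muln0 muln1 qfib0 dvdp0.
split=> //; have -> : (6 * m.+2 = 6 * m + 12)%N by lia.
rewrite -[qfib _](subrK ('X^2 * qfib (6 * m))).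
by rewrite Pdiv.Idomain.dvdp_add ?qfib_add12 ?Pdiv.Idomain.dvdp_mull.
Qed.

(* Divisibility in Z[q] is written out: %| on {poly int} is
   pseudo-divisibility, which ignores the constant factor 2. *)
Theorem mainTheorem2 (n : nat) (hn : (1 <= n)%N) :
  exists g : {poly int}, qfib (6 * n) = g * (2%:R * (1 + 'X) * (1 + 'X^2)).
Proof.
have [a aE] := qfib_mul3_even (2 * n); have := qfib_mul6_qint4 n.
move: aE; rewrite mulnA => ->; rewrite mulr_natl -scaler_nat.
(* Dropping the constant 2 leaves [qint4 %| a], and monicity gives a true quotient in Z[q]. *)
rewrite Pdiv.Idomain.dvdpZr // => /(Pdiv.IdomainMonic.dvdpP qint4_monic) [g ->].
by exists g; rewrite scaler_nat /qint4; ring.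
Qed.
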